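(* Let $n\ge 2$, let $(x_{i_1},\ldots,x_{i_k})$ be a finite sequence of Artin generators of the braid group $\mathcal{B}_n$, and let $a_1,\ldots,a_k\in\mathbb{Z}$. For $a\in\mathbb{Z}$ put $R_0^{[a]}(s)=(1-a)s^{a}$ and $R_1^{[a]}(s)=a s^{a-1}$. Write $D_n(\beta)(s)$ for the $D$ polynomial of the closure of an $n$-braid $\beta$. Then $$D_n(x_{i_1}^{a_1}x_{i_2}^{a_2}\cdots x_{i_k}^{a_k})(s)=\sum_{0\le j_1,\ldots,j_k\le 1}R_{j_1}^{[a_1]}(s)\cdots R_{j_k}^{[a_k]}(s)\,D_n(x_{i_1}^{j_1}\cdots x_{i_k}^{j_k})(s).$$
   Context: The $D$ polynomial is the oriented link invariant with values in $\mathbb{C}[s,s^{-1}]$ obtained from the HOMFLY polynomial $P(l,m)$ (normalized by $P(\bigcirc)=1$, with skein relation $lP(L_+)+l^{-1}P(L_-)+mP(L_0)=0$) by the specialization $l=s$, $m=-2$; equivalently $D(\bigcirc)=1$ (unknot) and $sD(L_+)+s^{-1}D(L_-)-2D(L_0)=0$ whenever $L_+,L_-,L_0$ are oriented diagrams identical except near one crossing, where $L_+$ has a positive crossing (both strands pointing up, the over-strand goes from lower left to upper right), $L_-$ a negative crossing and $L_0$ the oriented smoothing. Braid convention: $\mathcal{B}_n$ has Artin generators $x_1,\ldots,x_{n-1}$; in $x_i$ the strand going from top position $i$ to bottom position $i+1$ passes over the strand going from top position $i+1$ to bottom position $i$. Braids are oriented from top to bottom, so each crossing $x_i$ in the closure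 of a braid is a negative crossing (type $L_-$). *)

(* Defs.v *)
From HB Require Import structures.
From Stdlib Require Import Relation_Operators.
From mathcomp Require Import all_boot all_order all_algebra.
From mathcomp Require Import boolp reals complex zify.

Set Implicit Arguments.
Unset Strict Implicit.
Unset Printing Implicit Defensive.

Import GRing.Theory.

(* Oriented link diagrams, cut into horizontal slices.  A generic diagram in
   the plane is read from top to bottom; each slice contains one event (a local
   maximum, a local minimum or a crossing) with vertical strands on both sides.
   The horizontal lines between slices meet the diagram in a finite row of
   strands, recorded from left to right by their direction: [true] for a strand
   oriented downwards, [false] for a strand oriented upwards. *)

Inductive event :=
| Max of bool (* a cap: its left leg has the given direction *)
| Min of bool (* a cup: its left leg has the given direction *)
| Cross of bool & bool & bool.
(* [Cross b d1 d2]: the strand from upper left to lower right has direction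
   [d1], the one from upper right to lower left has direction [d2], and the
   former is the over-strand iff [b]. *)

Definition event_top (e : event) : seq bool :=
  match e with
  | Max _ => [::]
  | Min d => [:: d; ~~ d]
  | Cross _ d1 d2 => [:: d1; d2]
  end.

Definition event_bot (e : event) : seq bool :=
  match e with
  | Max d => [:: d; ~~ d]
  | Min _ => [::]
  | Cross _ d1 d2 => [:: d2; d1]
  end.

Definition slice := (seq bool * event * seq bool)%type.

Definition slice_top (x : slice) := let: (l, e, r) := x in l ++ event_top e ++ r.
Definition slice_bot (x : slice) := let: (l, e, r) := x in l ++ event_bot e ++ r.

Fixpoint composable (u : seq bool) (t : seq slice) (v : seq bool) : bool :=
  if t is x :: t' then (u == slice_top x) && composable (slice_bot x) t' v
  else u == v.

Record link_diagram := LinkDiagram {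
  slices :> seq slice;
  _ : composable [::] slices [::]
}.

HB.instance Definition _ := [isSub for slices].

(* Planar isotopy and Reidemeister moves for sliced diagrams, with arbitrary
   orientations and heights: exchanges of distant events, zigzags and slides
   generate planar isotopy. *)
Inductive local_move : seq slice -> seq slice -> Prop :=
| move_exchange e f m :
    local_move
      [:: ([::], e, m ++ event_top f); (event_bot e ++ m, f, [::])]
      [:: (event_top e ++ m, f, [::]); ([::], e, m ++ event_bot f)]
| move_zigzag_right d :
    local_move [:: ([:: d], Max (~~ d), [::]); ([::], Min d, [:: d])] [::]
| move_zigzag_left d :
    local_move [:: ([::], Max d, [:: d]); ([:: d], Min (~~ d), [::])] [::]
(* a crossing on one leg of an extremum is rotated to the other leg *)
| move_slide_max b d d' :
    local_move
      [:: ([:: d], Max d', [::]); ([::], Cross b d d', [:: ~~ d'])]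
      [:: ([::], Max d', [:: d]); ([:: d'], Cross (~~ b) (~~ d') d, [::])]
| move_slide_min b d d' :
    local_move
      [:: ([::], Cross b d d', [:: ~~ d]); ([:: d'], Min d, [::])]
      [:: ([:: d], Cross (~~ b) d' (~~ d), [::]); ([::], Min d, [:: d'])]
| move_R1_right b d :
    local_move
      [:: ([:: d], Max d, [::]); ([::], Cross b d d, [:: ~~ d]);
          ([:: d], Min d, [::])]
      [::]
| move_R1_left b d :
    local_move
      [:: ([::], Max (~~ d), [:: d]); ([:: ~~ d], Cross b d d, [::]);
          ([::], Min (~~ d), [:: d])]
      [::]
| move_R2 b d1 d2 :
    local_move
      [:: ([::], Cross b d1 d2, [::]); ([::], Cross (~~ b) d2 d1, [::])]
      [::]
(* [b12], [b13], [b23] say which of two strands, numbered at the top, is over;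
   the hypothesis excludes the two cyclic patterns. *)
| move_R3 b12 b13 b23 d1 d2 d3 :
    (b12 == b13) || (b13 == b23) ->
    local_move
      [:: ([::], Cross b12 d1 d2, [:: d3]); ([:: d2], Cross b13 d1 d3, [::]);
          ([::], Cross b23 d2 d3, [:: d1])]
      [:: ([:: d1], Cross b23 d2 d3, [::]); ([::], Cross b13 d1 d3, [:: d2]);
          ([:: d3], Cross b12 d1 d2, [::])].

Definition widen (l r : seq bool) (t : seq slice) : seq slice :=
  [seq (l ++ x.1.1, x.1.2, x.2 ++ r) | x <- t].

Definition isotopy_step (L L' : link_diagram) : Prop :=
  exists (A B t t' : seq slice) (l r : seq bool),
    [/\ local_move t t',
        L = A ++ widen l r t ++ B :> seq slice &
        L' = A ++ widen l r t' ++ B :> seq slice].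

Definition isotopic : link_diagram -> link_diagram -> Prop :=
  clos_refl_sym_trans link_diagram isotopy_step.

Definition unknot_slices (d : bool) : seq slice :=
  [:: ([::], Max d, [::]); ([::], Min d, [::])].

Lemma unknot_composable d : composable [::] (unknot_slices d) [::].
Proof. by rewrite /= !eqxx. Qed.

Definition unknot (d : bool) := LinkDiagram (unknot_composable d).

(* The crossing is drawn with both strands pointing up ([d = false]) or, after
   a half-turn of the plane, both pointing down ([d = true]).  It is positive
   iff the over-strand is the one through lower left and upper right. *)
Definition skein_triple (Lp Lm L0 : link_diagram) : Prop :=
  exists (A B : seq slice) (l r : seq bool) (d : bool),
    [/\ Lp = A ++ (l, Cross false d d, r) :: B :> seq slice,
        Lm = A ++ (l, Cross true d d, r) :: B :> seq slice &
        L0 = A ++ B :> seq slice].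

(* C[s, s^-1] is realized inside the field of fractions of C[s]. *)

Section DPolynomial.
Variable R : realType.
Local Open Scope ring_scope.

Definition svar : {fraction {poly R[i]}} := tofrac 'X.

Definition is_laurent (f : {fraction {poly R[i]}}) : Prop :=
  exists (p : {poly R[i]}) (m : nat), f = tofrac p / svar ^+ m.

(* The values of [D] on links with at least one component are determined. *)
Record is_D_polynomial (D : link_diagram -> {fraction {poly R[i]}}) : Prop := {
  D_laurent : forall L, is_laurent (D L);
  D_isotopic : forall L L', isotopic L L' -> D L = D L';
  D_unknot : forall d, D (unknot d) = 1;
  D_skein : forall Lp Lm L0, skein_triple Lp Lm L0 ->
    svar * D Lp + svar^-1 * D Lm - 2%:R * D L0 = 0
}.

Definition Rcoef (j : 'I_2) (a : int) : {fraction {poly R[i]}} :=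
  if j == 0 then (1 - a%:~R) * svar ^ a else a%:~R * svar ^ (a - 1).

End DPolynomial.

(* The braid group on n strands, by Artin's presentation.  Generators are
   numbered from 0; [(i, true)] is a generator and [(i, false)] its inverse. *)

Section BraidGroup.
Variable n : nat.

Definition braid_word := seq ('I_n.-1 * bool).

Inductive artin_relation : braid_word -> braid_word -> Prop :=
| artin_cancel i b : artin_relation [:: (i, b); (i, ~~ b)] [::]
| artin_far (i j : 'I_n.-1) : i.+1 < j ->
    artin_relation [:: (i, true); (j, true)] [:: (j, true); (i, true)]
| artin_braid (i j : 'I_n.-1) : j = i.+1 :> nat ->
    artin_relation [:: (i, true); (j, true); (i, true)]
                   [:: (j, true); (i, true); (j, true)].

Definition braid_step (w w' : braid_word) : Prop :=
  exists A B u v : braid_word,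
    [/\ artin_relation u v, w = A ++ u ++ B & w' = A ++ v ++ B].

Definition braid_equiv : braid_word -> braid_word -> Prop :=
  clos_refl_sym_trans braid_word braid_step.

Definition braid_equivb (w w' : braid_word) : bool := `[< braid_equiv w w' >].

Lemma braid_equivb_refl : reflexive braid_equivb.
Proof. by move=> w; apply/asboolP; apply: rst_refl. Qed.

Lemma braid_equivb_sym : symmetric braid_equivb.
Proof.
by move=> w w'; apply/idP/idP => /asboolP h; apply/asboolP; apply: rst_sym.
Qed.

Lemma braid_equivb_trans : transitive braid_equivb.
Proof.
by move=> w v u /asboolP h1 /asboolP h2; apply/asboolP; apply: rst_trans h1 h2.
Qed.

Canonical braid_equivb_equiv :=
  EquivRel braid_equivb braid_equivb_refl braid_equivb_sym braid_equivb_trans.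

Definition braid := {eq_quot braid_equivb}%qT.
HB.instance Definition _ := Choice.on braid.
HB.instance Definition _ := EqQuotient.on braid.

Definition braid_pi (w : braid_word) : braid := \pi_braid%qT w.

Lemma braid_piP w w' : braid_equiv w w' <-> braid_pi w = braid_pi w'.
Proof.
split=> [h|/eqmodP/asboolP//]; apply/eqmodP; exact/asboolP.
Qed.

Definition braid_word_inv (w : braid_word) : braid_word :=
  rev [seq (x.1, ~~ x.2) | x <- w].

Lemma braid_equiv_cat A B w w' :
  braid_equiv w w' -> braid_equiv (A ++ w ++ B) (A ++ w' ++ B).
Proof.
elim=> [u v [A' [B' [x [y [xy -> ->]]]]]|u|u v _ IH|u v z _ IH1 _ IH2].
- apply: rst_step; exists (A ++ A'), (B' ++ B), x, y.
  by rewrite !catA.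
- exact: rst_refl.
- exact: rst_sym.
- exact: rst_trans IH1 IH2.
Qed.

Lemma braid_word_invV w : braid_equiv (braid_word_inv w ++ w) [::].
Proof.
elim: w => [|[i b] w IH]; first exact: rst_refl.
apply: (rst_trans _ _ _ (braid_word_inv w ++ w)) IH.
rewrite /braid_word_inv /= rev_cons cat_rcons.
apply: rst_step; exists (rev [seq (x.1, ~~ x.2) | x <- w]), w.
exists [:: (i, ~~ b); (i, b)], [::].
by split=> //; rewrite -{2}(negbK b); apply: artin_cancel.
Qed.

Lemma braid_word_invK : involutive braid_word_inv.
Proof.
move=> w; rewrite /braid_word_inv map_rev revK -map_comp.
by rewrite -[RHS]map_id; apply: eq_map => -[i b] /=; rewrite negbK.
Qed.

Lemma braid_word_inv_cat u v :
  braid_word_inv (u ++ v) = braid_word_inv v ++ braid_word_inv u.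
Proof. by rewrite /braid_word_inv map_cat rev_cat. Qed.

Lemma braid_equiv_inv w w' :
  braid_equiv w w' -> braid_equiv (braid_word_inv w) (braid_word_inv w').
Proof.
move=> h; have {}h := braid_equiv_cat (braid_word_inv w) (braid_word_inv w') h.
have h1 : braid_equiv (braid_word_inv w ++ w ++ braid_word_inv w')
                      (braid_word_inv w').
  by rewrite catA; apply: (braid_equiv_cat [::] _ (braid_word_invV w)).
have h2 : braid_equiv (braid_word_inv w ++ w' ++ braid_word_inv w')
                      (braid_word_inv w).
  have := braid_equiv_cat (braid_word_inv w) [::]
    (braid_word_invV (braid_word_inv w')).
  by rewrite braid_word_invK !cats0.
apply: rst_trans (rst_sym _ _ _ _ h2) _.
exact: rst_trans (rst_sym _ _ _ _ h) h1.
Qed.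

(* In a product the left factor is drawn on top. *)
Definition braid_mul (x y : braid) : braid :=
  braid_pi (repr x ++ repr y).
Definition braid_inv (x : braid) : braid := braid_pi (braid_word_inv (repr x)).

Lemma braid_repr w : braid_equiv (repr (braid_pi w)) w.
Proof. by apply/braid_piP; rewrite /braid_pi reprK. Qed.

Lemma braid_mul_pi u v : braid_mul (braid_pi u) (braid_pi v) = braid_pi (u ++ v).
Proof.
apply/braid_piP; apply: (rst_trans _ _ _ (u ++ repr (braid_pi v))).
  exact: (braid_equiv_cat [::] _ (braid_repr u)).
have := braid_equiv_cat u [::] (braid_repr v).
by rewrite !cats0.
Qed.

Lemma braid_inv_pi u : braid_inv (braid_pi u) = braid_pi (braid_word_inv u).
Proof. by apply/braid_piP; apply/braid_equiv_inv/braid_repr. Qed.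

Lemma braid_ind (P : braid -> Prop) : (forall w, P (braid_pi w)) -> forall x, P x.
Proof. by move=> h x; rewrite -[x]reprK; apply: h. Qed.

Lemma braid_mulA : associative braid_mul.
Proof.
by elim/braid_ind=> u; elim/braid_ind=> v; elim/braid_ind=> w;
   rewrite !braid_mul_pi catA.
Qed.

Lemma braid_mul1l : left_id (braid_pi [::]) braid_mul.
Proof. by elim/braid_ind=> u; rewrite braid_mul_pi. Qed.

Lemma braid_mul1r : right_id (braid_pi [::]) braid_mul.
Proof. by elim/braid_ind=> u; rewrite braid_mul_pi cats0. Qed.

Lemma braid_mulV : left_inverse (braid_pi [::]) braid_inv braid_mul.
Proof.
elim/braid_ind=> u; rewrite braid_inv_pi braid_mul_pi.
by apply/braid_piP/braid_word_invV.
Qed.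

Lemma braid_mulrV : right_inverse (braid_pi [::]) braid_inv braid_mul.
Proof.
elim/braid_ind=> u; rewrite braid_inv_pi braid_mul_pi.
by apply/braid_piP; rewrite -{1}(braid_word_invK u); apply/braid_word_invV.
Qed.

HB.instance Definition _ := isGroup.Build braid
  braid_mulA braid_mul1l braid_mul1r braid_mulV braid_mulrV.

Definition artin_gen (i : 'I_n.-1) : braid := braid_pi [:: (i, true)].

End BraidGroup.

Definition zexpg (G : groupType) (x : G) (a : int) : G :=
  match a with
  | Posz m => (x ^+ m)%g
  | Negz m => (x ^- m.+1)%g
  end.

(* The closure of a braid word: the n strands of the braid run downwards on the
   left, and the n closing strands run upwards on the right. *)

Section Closure.
Variable n : nat.

Definition letter_slice (x : 'I_n.-1 * bool) : slice :=
  (nseq x.1 true, Cross x.2 true true, nseq (n - x.1.+2) true ++ nseq n false).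

Definition closure_slices (w : braid_word n) : seq slice :=
  [seq (nseq j true, Max true, nseq j false) | j <- iota 0 n]
  ++ map letter_slice w
  ++ [seq (nseq j true, Min true, nseq j false) | j <- rev (iota 0 n)].

Lemma composable_cat v s t u w :
  composable u s v -> composable v t w -> composable u (s ++ t) w.
Proof.
elim: s u => [|x s IH] u /=; first by move/eqP->.
by case/andP=> /eqP-> h1 h2; rewrite eqxx IH.
Qed.

Lemma nseq_true_false j :
  nseq j true ++ [:: true, false & nseq j false]
  = nseq j.+1 true ++ nseq j.+1 false.
Proof. by rewrite -cat_rcons; congr (_ ++ _); elim: j => //= j ->. Qed.

Lemma iotaSr m : iota 0 m.+1 = rcons (iota 0 m) m.
Proof. by rewrite -addn1 iotaD cats1 add0n. Qed.

Lemma letter_top (i : 'I_n.-1) :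
  nseq i true ++ [:: true, true & nseq (n - i.+2) true ++ nseq n false]
  = nseq n true ++ nseq n false.
Proof.
have lt_in : i.+2 <= n by rewrite -ltn_predRL.
have -> : nseq n true = nseq (i + 2 + (n - i.+2)) true.
  by rewrite addn2 subnKC.
by rewrite !nseqD -!catA.
Qed.

Lemma closure_composable w : composable [::] (closure_slices w) [::].
Proof.
apply: (@composable_cat (nseq n true ++ nseq n false)).
  elim: (n) => // m IH; rewrite iotaSr map_rcons -cats1.
  apply: composable_cat IH _ => /=.
  by rewrite eqxx nseq_true_false eqxx.
apply: (@composable_cat (nseq n true ++ nseq n false)).
  elim: w => [|[i b] w IH]; first exact/eqP.
  by rewrite /= letter_top eqxx.
elim: (n) => // m IH; rewrite iotaSr rev_rcons /=.
by rewrite nseq_true_false eqxx.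
Qed.

Definition braid_closure (w : braid_word n) : link_diagram :=
  LinkDiagram (closure_composable w).

Lemma letter_shift (p q : nat) (x : 'I_n.-1 * bool) :
  x.1 = (p + q)%N :> nat ->
  letter_slice x =
  (nseq p true ++ nseq q true, Cross x.2 true true,
   nseq (n - (p + q).+2) true ++ nseq n false).
Proof. by move=> xpq; rewrite /letter_slice xpq nseqD. Qed.

Lemma artin_relation_local_move u v : artin_relation u v ->
  exists t t' l r, [/\ local_move t t', map letter_slice u = widen l r t
                                     & map letter_slice v = widen l r t'].
Proof.
case=> {u v} [i b|i j ij|i j ij].
- exists [:: ([::], Cross b true true, [::]);
             ([::], Cross (~~ b) true true, [::])], [::].
  exists (nseq i true), (nseq (n - i.+2) true ++ nseq n false).
  split; [exact: move_R2| |by []].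
  by rewrite /= /letter_slice /= cats0.
- pose m := nseq (j - i.+2) true; pose e := Cross true true true.
  exists [:: ([::], e, m ++ event_top e); (event_bot e ++ m, e, [::])].
  exists [:: (event_top e ++ m, e, [::]); ([::], e, m ++ event_bot e)].
  exists (nseq i true), (nseq (n - j.+2) true ++ nseq n false).
  have jE : j = (i + (j - i.+2).+2)%N :> nat.
    by rewrite !addnS -!addSn subnKC.
  have nE : (n - i.+2 = (j - i.+2) + (2 + (n - j.+2)))%N.
    have ltj : j.+2 <= n by rewrite -ltn_predRL.
    by lia.
  split; first exact: move_exchange.
    rewrite /= {1}/letter_slice /= nE !nseqD -!catA /=.
    by rewrite (@letter_shift i (j - i.+2).+2) //= -jE cats0.
  rewrite /= (@letter_shift i (j - i.+2).+2) //= -jE.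
  by rewrite /letter_slice /= nE !nseqD -!catA cats0.
have ltj : i.+3 <= n by rewrite -ij -ltn_predRL.
have nE : (n - i.+2 = (n - i.+3).+1)%N by rewrite -subSn.
exists [:: ([::], Cross true true true, [:: true]);
           ([:: true], Cross true true true, [::]);
           ([::], Cross true true true, [:: true])].
exists [:: ([:: true], Cross true true true, [::]);
           ([::], Cross true true true, [:: true]);
           ([:: true], Cross true true true, [::])].
exists (nseq i true), (nseq (n - i.+3) true ++ nseq n false).
have jE : letter_slice (j, true) =
          (nseq i true ++ [:: true], Cross true true true,
           nseq (n - i.+3) true ++ nseq n false).
  by rewrite (@letter_shift i 1) ?addn1.
split; first exact: move_R3.
  by rewrite /= jE {1 2}/letter_slice /= nE cats0.
by rewrite /= jE {1}/letter_slice /= nE cats0.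
Qed.

Lemma braid_closure_isotopic w w' :
  braid_equiv w w' -> isotopic (braid_closure w) (braid_closure w').
Proof.
elim=> [u v [A [B [x [y [xy -> ->]]]]]|u|u v _ IH|u v z _ IH1 _ IH2].
- have [t [t' [l [r [tt' xt yt]]]]] := artin_relation_local_move xy.
  apply: rst_step.
  exists ([seq (nseq j true, Max true, nseq j false) | j <- iota 0 n]
          ++ map letter_slice A).
  exists (map letter_slice B
          ++ [seq (nseq j true, Min true, nseq j false) | j <- rev (iota 0 n)]).
  exists t, t', l, r; split=> //.
    by rewrite /= /closure_slices !map_cat xt -!catA.
  by rewrite /= /closure_slices !map_cat yt -!catA.
- exact: rst_refl.
- exact: rst_sym.
- exact: rst_trans IH1 IH2.
Qed.

End Closure.

Section BraidD.
Variables (R : realType) (D : link_diagram -> {fraction {poly R[i]}}) (n : nat).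

(* [repr] picks a word for the braid [x]; the choice is irrelevant, see
   [braidD_pi]. *)
Definition braidD (x : braid n) : {fraction {poly R[i]}} :=
  D (braid_closure (repr x)).

Lemma braidD_pi w :
  is_D_polynomial D -> braidD (braid_pi w) = D (braid_closure w).
Proof. by move/D_isotopic; apply; apply/braid_closure_isotopic/braid_repr. Qed.

End BraidD.

(* Main.v *)
(* The skein relation at a letter [x_i^b] inside a braid word is a linear
   recurrence of order two in the exponent [b], with characteristic polynomial
   [(r - s)^2].  Its solutions are the combinations of [s^b] and [b s^b], which
   expresses the value at exponent [a] through those at exponents 0 and 1; the
   theorem is the multilinear expansion of this over all letters. *)

Require Import Defs.
From mathcomp Require Import all_boot all_order all_algebra.
From mathcomp Require Import boolp reals complex.
From mathcomp Require Import ring.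

Set Implicit Arguments.
Unset Strict Implicit.
Unset Printing Implicit Defensive.

Import GRing.Theory.

Local Open Scope ring_scope.

Lemma zexpgS (G : groupType) (x : G) (a : int) :
  zexpg x (a + 1) = (x * zexpg x a)%g.
Proof.
case: a => [m|[|m]] /=; first by rewrite addn1 expgS.
  by rewrite expg1 mulgV.
by rewrite subn1 /= [in RHS]expgSr invgM mulVKg.
Qed.

(** A function on ['I_k.+1] is the same as its value at [ord0] together with its restriction to the
    lifted indices. *)
Lemma sum_ffun_recl (V : nmodType) (J : finType) k
    (F : {ffun 'I_k.+1 -> J} -> V) :
  \sum_f F f =
  \sum_j \sum_(f : {ffun 'I_k -> J})
    F [ffun t => if unlift ord0 t is Some t' then f t' else j].
Proof.
rewrite pair_bigA /= (reindex (fun p : J * {ffun 'I_k -> J} =>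
  [ffun t => if unlift ord0 t is Some t' then p.2 t' else p.1])) //=.
exists (fun f : {ffun 'I_k.+1 -> J} => (f ord0, [ffun t => f (lift ord0 t)])).
  move=> [j f] _ /=; rewrite ffunE unlift_none; congr pair.
  by apply/ffunP=> t; rewrite !ffunE liftK.
move=> f _; apply/ffunP=> t; rewrite ffunE.
by case: unliftP => [t'|] -> /=; rewrite ?ffunE.
Qed.

(** [phi] need not be multiplicative: since the hypothesis holds in every context [u], [v], the
    factors can be expanded one at a time. *)
Lemma expand_prod (G : monoidType) (K : comPzRingType) (J : finType)
    (phi : G -> K) k (y : 'I_k -> G) (z : 'I_k -> J -> G) (c : 'I_k -> J -> K) :
  (forall t u v,
     phi (u * y t * v)%g = \sum_j c t j * phi (u * z t j * v)%g) ->
  phi (\prod_t y t)%g =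
  \sum_(f : {ffun 'I_k -> J})
    (\prod_t c t (f t)) * phi (\prod_t z t (f t))%g.
Proof.
move=> yE.
(* A free prefix [u] is needed in the induction: it absorbs the factor [z ord0 j] chosen for the
   head. *)
suff expand_after u : phi (u * \prod_t y t)%g =
    \sum_(f : {ffun 'I_k -> J})
      (\prod_t c t (f t)) * phi (u * \prod_t z t (f t))%g.
  by rewrite -[X in phi X]mul1g expand_after; under eq_bigr do rewrite mul1g.
elim: k y z c yE u => [|k IH] y z c yE u.
  have f0 : {ffun 'I_0 -> J} := ffun0 (card_ord 0).
  rewrite (big_pred1 f0) => [|f]; last first.
    by apply/esym/eqP/ffunP=> -[].
  by rewrite !big_ord0 mul1r.
rewrite big_ord_recl mulgA yE sum_ffun_recl; apply: eq_bigr => j _.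
rewrite (IH _ (fun t => z (lift ord0 t)) (fun t => c (lift ord0 t))); last first.
  by move=> t; apply: yE.
rewrite big_distrr /=; apply: eq_bigr => f _.
rewrite !big_ord_recl ffunE unlift_none mulrA mulgA.
congr (_ * _ * phi (_ * _)%g); apply: eq_bigr => t _;
  by rewrite ffunE liftK.
Qed.

(** Dividing [f a] by [s ^ a] moves the double root to 1, so [h] has constant differences [d] and is
    affine in [a]. *)
Lemma double_root_recurrence (K : fieldType) (s : K) (f : int -> K) :
  s != 0 ->
  (forall a, s * f a + s^-1 * f (a + 2) - 2%:R * f (a + 1) = 0) ->
  forall a, f a = (1 - a%:~R) * s ^ a * f 0 + a%:~R * s ^ (a - 1) * f 1.
Proof.
move=> s0 fE; pose h a := s ^ (- a) * f a; pose d a := h (a + 1) - h a.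
have dS a : d (a + 1) = d a.
  have sa : s ^ a != 0 by apply: expfz_neq0.
  apply/eqP; rewrite -subr_eq0; apply/eqP.
  (* The second difference of [h] at [a] is the recurrence at [a] scaled by [s ^ (- a - 1)]. *)
  transitivity ((s ^ a)^-1 * s^-1 *
    (s * f a + s^-1 * f (a + 2) - 2%:R * f (a + 1))); last by rewrite fE mulr0.
  rewrite /d /h -[a + 1 + 1]addrA -!invr_expz !expfzDr //.
  rewrite -[(1 + 1 : int)]/(2 : int) !expr1z.
  by field; rewrite s0 sa.
have dE a : d a = d 0.
  elim/int_ind: a => // m IH; first by rewrite -IH -[in RHS]dS intS addrC.
  by rewrite -IH -dS; congr d; rewrite intS; ring.
have hS a : h (a + 1) = h a + d 0 by rewrite -(dE a) /d [RHS]addrC subrK.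
have hE a : h a = h 0 + a%:~R * d 0.
  elim/int_ind: a => [|m IH|m IH]; first by rewrite mul0r addr0.
    by rewrite intS [X in h X]addrC hS IH; ring.
  (* For negative arguments [hS] is used backwards, from [- m] down to [- m - 1]. *)
  apply: (addIr (d 0)); rewrite -hS.
  have -> : - m.+1%:Z + 1 = - m%:Z by rewrite intS; ring.
  by rewrite IH intS; ring.
move=> a; have sa : s ^ a != 0 by apply: expfz_neq0.
have -> : f a = s ^ a * h a by rewrite /h -invr_expz mulVKf.
(* Here [h 0 = f 0] and [d 0 = s^-1 * f 1 - f 0]. *)
rewrite hE /d add0r /h oppr0 expfzDr // -!invr_expz !expr1z expr0z.
by field; rewrite s0.
Qed.

Lemma svar_neq0 (R : realType) : svar R != 0.
Proof. by rewrite /svar tofrac_eq0 polyX_eq0. Qed.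

(** A generator closes to a negative crossing, so exponent 2 takes the place of [Lm] and exponent 0
    that of [Lp]. *)
Lemma braidD_skein (R : realType)
    (D : link_diagram -> {fraction {poly R[i]}}) (D_poly : is_D_polynomial D)
    n (u v : braid n) (i : 'I_n.-1) :
  svar R * braidD D (u * v)%g
  + (svar R)^-1 * braidD D (u * artin_gen i ^+ 2 * v)%g
  - 2%:R * braidD D (u * artin_gen i * v)%g = 0.
Proof.
have mulE x y : (braid_pi x * braid_pi y)%g = braid_pi (x ++ y) :> braid n.
  exact: braid_mul_pi.
have genE b : braid_pi [:: (i, b)] =
    (if b then artin_gen i else (artin_gen i)^-1)%g.
  by case: b => //; rewrite [RHS]braid_inv_pi.
(* Absorbing [x_i] into [U], the words with [x_i^-1], [x_i] and no letter between
   [U] and [V] form a skein triple. *)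
pose U := repr (u * artin_gen i)%g; pose V := repr v.
have wordE w : braidD D (u * artin_gen i * braid_pi w * v)%g =
    D (braid_closure (U ++ w ++ V)).
  by rewrite -(braidD_pi _ D_poly) -!mulE /U /V /braid_pi !reprK mulgA.
have := wordE [:: (i, false)]; have := wordE [:: (i, true)].
have := wordE [::]; rewrite !genE mulgK.
rewrite -[braid_pi [::]]/(1%g : braid n) mulg1 expgS expg1 mulgA.
move=> -> -> ->; apply: (D_skein D_poly).
exists ([seq (nseq j true, Max true, nseq j false) | j <- iota 0 n]
        ++ map (@letter_slice n) U).
exists (map (@letter_slice n) V
        ++ [seq (nseq j true, Min true, nseq j false) | j <- rev (iota 0 n)]).
exists (nseq i true), (nseq (n - i.+2) true ++ nseq n false), true.
by split; rewrite /= /closure_slices !map_cat -!catA.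
Qed.

Lemma braidD_zexpg (R : realType)
    (D : link_diagram -> {fraction {poly R[i]}}) (D_poly : is_D_polynomial D)
    n (u v : braid n) (i : 'I_n.-1) (a : int) :
  braidD D (u * zexpg (artin_gen i) a * v)%g =
  \sum_(j < 2) Rcoef R j a * braidD D (u * artin_gen i ^+ j * v)%g.
Proof.
rewrite !big_ord_recl big_ord0 addr0 /Rcoef /=.
pose f b := braidD D (u * zexpg (artin_gen i) b * v)%g.
apply: (@double_root_recurrence _ (svar R) f) (svar_neq0 R) _ _ => b.
(* Putting [x_i^b] into the right context turns the exponents 0, 1, 2 into [b], [b + 1], [b + 2]. *)
have := braidD_skein D_poly u (zexpg (artin_gen i) b * v)%g i.
rewrite /f -[(2 : int)]/(1 + 1 : int) addrA !zexpgS expgS expg1 !mulgA.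
by [].
Qed.

Theorem theorem1p8 (R : realType)
    (D : link_diagram -> {fraction {poly R[i]}}) (D_poly : is_D_polynomial D)
    (n : nat) (n_ge2 : (2 <= n)%N)
    (k : nat) (g : 'I_k -> 'I_n.-1) (a : 'I_k -> int) :
  braidD D (\prod_(t < k) zexpg (artin_gen (g t)) (a t))%g =
  \sum_(j : {ffun 'I_k -> 'I_2})
     (\prod_(t < k) Rcoef R (j t) (a t)) *
     braidD D (\prod_(t < k) artin_gen (g t) ^+ j t)%g.
Proof.
apply: (@expand_prod _ _ _ (@braidD R D n) k _
  (fun t (j : 'I_2) => artin_gen (g t) ^+ j)%g
  (fun t j => Rcoef R j (a t))) => t u v.
exact: braidD_zexpg.
Qed.
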